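(* Let $d,n\geq1$ be integers. The elements $t_1,\dots,t_n,J_1,\dots,J_n$, that is, the Jucys--Murphy elements of ${\rm Y}_{d,n}(q)$, form a commutative set of elements (any two of them commute).
   Context: Let $q$ be an indeterminate. The Yokonuma--Hecke algebra ${\rm Y}_{d,n}(q)$ is the associative unital $\mathbb{C}[q,q^{-1}]$-algebra generated by $g_1,\dots,g_{n-1},t_1,\dots,t_n$ subject to: $g_ig_j=g_jg_i$ for $|i-j|>1$; $g_ig_{i+1}g_i=g_{i+1}g_ig_{i+1}$ for $i=1,\dots,n-2$; $t_it_j=t_jt_i$ for all $i,j$; $t_jg_i=g_it_{s_i(j)}$ for all $i,j$, where $s_i$ is the transposition $(i,i+1)$; $t_j^d=1$ for all $j$; and $g_i^2=1+(q-q^{-1})e_ig_i$ for all $i$, where $e_i=\frac1d\sum_{s=0}^{d-1}t_i^st_{i+1}^{-s}$. The elements $J_i$ are defined by $J_1:=1$ and $J_{i+1}:=g_iJ_ig_i$ for $i=1,\dots,n-1$. *)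

(* Defs.v *)
From HB Require Import structures.
From mathcomp Require Import all_boot all_order all_fingroup all_algebra.
From mathcomp Require Import complex.
From mathcomp Require Import generic_quotient ring_quotient.
From mathcomp Require Import boolp reals.
From mathcomp Require Import finmap monalg.

Set Implicit Arguments.
Unset Strict Implicit.
Unset Printing Implicit Defensive.

Import GRing.Theory.
Local Open Scope ring_scope.

Section LaurentPolynomials.
Variable F : fieldType.

Definition laurent_pred : {pred {fraction {poly F}}} :=
  fun x => `[< exists (p : {poly F}) (k : nat),
               x = tofrac p / tofrac ('X^k) >].

Fact tofracXn_neq0 k : tofrac ('X^k : {poly F}) != 0.
Proof. by rewrite tofrac_eq0 monic_neq0 ?monicXn. Qed.

Fact laurent_subring_closed : subring_closed laurent_pred.
Proof.
have D (p r : {poly F}) : tofrac (p * r) = tofrac p * tofrac r by exact: rmorphM.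
split.
- by apply/asboolP; exists 1, 0%N; rewrite expr0 divff ?oner_neq0.
- move=> x y /asboolP[p [k ->]] /asboolP[r [l ->]]; apply/asboolP.
  exists (p * 'X^l - r * 'X^k), (k + l)%N.
  rewrite exprD rmorphB /= !D -mulNr addf_div ?tofracXn_neq0 //.
  by rewrite mulNr.
- move=> x y /asboolP[p [k ->]] /asboolP[r [l ->]]; apply/asboolP.
  by exists (p * r), (k + l)%N; rewrite exprD !D mulf_div.
Qed.

HB.instance Definition _ :=
  GRing.isSubringClosed.Build {fraction {poly F}} laurent_pred
    laurent_subring_closed.

(* F[q, q^-1], as the subring of the fraction field F(q) of F[q] made of the
   fractions whose denominator is a power of q *)
Record laurent : predArgType := Laurent {
  laurent_val : {fraction {poly F}};
  laurent_valP : laurent_val \in laurent_pred }.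

HB.instance Definition _ := [isSub for laurent_val].
HB.instance Definition _ := [Choice of laurent by <:].
HB.instance Definition _ := [SubChoice_isSubComNzRing of laurent by <:].

Fact laurentC_subproof (c : F) : tofrac (c%:P) \in laurent_pred.
Proof. by apply/asboolP; exists c%:P, 0%N; rewrite expr0 tofrac1 divr1. Qed.

Fact laurentX_subproof : tofrac ('X : {poly F}) \in laurent_pred.
Proof. by apply/asboolP; exists 'X, 0%N; rewrite expr0 tofrac1 divr1. Qed.

Fact laurentXV_subproof : (tofrac ('X : {poly F}))^-1 \in laurent_pred.
Proof. by apply/asboolP; exists 1, 1%N; rewrite expr1 tofrac1 div1r. Qed.

Definition laurentC (c : F) : laurent := Laurent (laurentC_subproof c).
Definition laurentX : laurent := Laurent laurentX_subproof.
Definition laurentXV : laurent := Laurent laurentXV_subproof.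

Lemma laurentXXV : laurentX * laurentXV = 1.
Proof. by apply: val_inj; rewrite /= divff // -['X]expr1 tofracXn_neq0. Qed.

Fact laurentC_is_zmod_morphism : zmod_morphism laurentC.
Proof. by move=> a b; apply: val_inj; rewrite /= !rmorphB. Qed.

Fact laurentC_is_monoid_morphism : monoid_morphism laurentC.
Proof. by split=> [|a b]; apply: val_inj; rewrite /= ?rmorph1 ?rmorphM. Qed.

HB.instance Definition _ :=
  GRing.isZmodMorphism.Build F laurent laurentC laurentC_is_zmod_morphism.
HB.instance Definition _ :=
  GRing.isMonoidMorphism.Build F laurent laurentC laurentC_is_monoid_morphism.

End LaurentPolynomials.

Section FreeAlgebra.
Variables (K : comNzRingType) (I : choiceType).

Definition free_algebra := {malg K[{fmonom I}]}.

HB.instance Definition _ := GRing.Lalgebra.on free_algebra.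

Fact free_algebra_scalerAr (k : K) (x y : free_algebra) :
  k *: (x * y) = x * (k *: y).
Proof.
have scC (z : free_algebra) : k%:MP * z = z * k%:MP.
  rewrite !malgM_def fgmulUg fgmulgU; apply: eq_bigr => m _.
  by rewrite mul1m mulm1 mulrC.
by rewrite -[LHS]mul_malgC mulrA scC -mulrA -mul_malgC.
Qed.

HB.instance Definition _ :=
  GRing.Lalgebra_isAlgebra.Build K free_algebra free_algebra_scalerAr.

End FreeAlgebra.

HB.lock Definition free_gen (K : comNzRingType) (I : choiceType) (i : I) :
  free_algebra K I := << fmu i >>.

Section TwoSidedIdeal.
Variables (A : nzRingType) (r : A -> A -> Prop).

Inductive ideal_gen : A -> Prop :=
| ideal_gen_rel x y : r x y -> ideal_gen (x - y)
| ideal_gen0 : ideal_gen 0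
| ideal_genD x y : ideal_gen x -> ideal_gen y -> ideal_gen (x + y)
| ideal_genMl a x : ideal_gen x -> ideal_gen (a * x)
| ideal_genMr a x : ideal_gen x -> ideal_gen (x * a).

Definition two_sided_ideal : {pred A} := fun x => `[< ideal_gen x >].

Fact two_sided_ideal_zmod_closed : zmod_closed two_sided_ideal.
Proof.
split=> [|x y /asboolP xI /asboolP yI]; apply/asboolP.
  exact: ideal_gen0.
by apply: ideal_genD => //; rewrite -mulN1r; apply: ideal_genMl.
Qed.

HB.instance Definition _ :=
  GRing.isZmodClosed.Build A two_sided_ideal two_sided_ideal_zmod_closed.

Lemma two_sided_idealMl a x : x \in two_sided_ideal -> a * x \in two_sided_ideal.
Proof. by move/asboolP=> xI; apply/asboolP/ideal_genMl. Qed.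

Lemma two_sided_idealMr a x : x \in two_sided_ideal -> x * a \in two_sided_ideal.
Proof. by move/asboolP=> xI; apply/asboolP/ideal_genMr. Qed.

End TwoSidedIdeal.

(* The quotient of A by the two-sided ideal generated by the x - y, r x y. It
   is only a pzRingType here, as it may be trivial. *)
Section PresentedAlgebra.
Variables (K : comNzRingType) (A : algType K) (r : A -> A -> Prop).

Local Notation I := (two_sided_ideal r).

Definition presented := @Quotient.quot A I.

HB.instance Definition _ := EqQuotient.on presented.
HB.instance Definition _ := GRing.Zmodule.on presented.

Definition proj (x : A) : presented := \pi_presented%qT x.

Lemma projP x y : reflect (proj x = proj y) (x - y \in I).
Proof. rewrite /proj Quotient.idealrBE. exact: (iffP eqP). Qed.

Lemma proj_surj (u : presented) : {x | proj x = u}.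
Proof. by exists (repr u); rewrite /proj reprK. Qed.

Lemma proj_rel x y : r x y -> proj x = proj y.
Proof. by move=> rxy; apply/projP/asboolP/ideal_gen_rel. Qed.

Lemma projB : zmod_morphism proj.
Proof. by move=> x y; rewrite /proj !piE. Qed.

HB.instance Definition _ := GRing.isZmodMorphism.Build A presented proj projB.

Lemma projD : {morph proj : x y / x + y}.
Proof. exact: raddfD. Qed.

End PresentedAlgebra.

(* locked, as deciding the convertibility of two products is intractable *)
HB.lock Definition presented_mul (K : comNzRingType) (A : algType K)
    (r : A -> A -> Prop) (u v : presented r) : presented r :=
  proj r (repr u * repr v).
HB.lock Definition presented_scale (K : comNzRingType) (A : algType K)
    (r : A -> A -> Prop) (c : K) (u : presented r) : presented r :=
  proj r (c *: repr u).

Section PresentedAlgebraTheory.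
Variables (K : comNzRingType) (A : algType K) (r : A -> A -> Prop).

Local Notation I := (two_sided_ideal r).
Local Notation presented := (presented r).
Local Notation proj := (proj r).
Local Notation presented_mul := (@presented_mul K A r).
Local Notation presented_scale := (@presented_scale K A r).

Lemma projM x y : proj (x * y) = presented_mul (proj x) (proj y).
Proof.
rewrite presented_mul.unlock; apply/projP; set x' := repr _; set y' := repr _.
have xI : x - x' \in I by apply/projP; rewrite /x' /proj reprK.
have yI : y - y' \in I by apply/projP; rewrite /y' /proj reprK.
rewrite -[_ - _](subrKA (x' * y)) -mulrBl -mulrBr.
by apply: rpredD; [apply: two_sided_idealMr | apply: two_sided_idealMl].
Qed.

Lemma projZ c x : proj (c *: x) = presented_scale c (proj x).
Proof.
rewrite presented_scale.unlock; apply/projP; set x' := repr _.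
rewrite -scalerBr -mulr_algl two_sided_idealMl //.
by apply/projP; rewrite /x' /proj reprK.
Qed.

Fact presented_mulA : associative presented_mul.
Proof.
move=> u v w; have [x <-] := proj_surj u; have [y <-] := proj_surj v.
by have [z <-] := proj_surj w; rewrite -!projM mulrA.
Qed.

Fact presented_mul1 : left_id (proj 1) presented_mul.
Proof. by move=> u; have [x <-] := proj_surj u; rewrite -projM mul1r. Qed.

Fact presented_mulr1 : right_id (proj 1) presented_mul.
Proof. by move=> u; have [x <-] := proj_surj u; rewrite -projM mulr1. Qed.

Fact presented_mulDl : left_distributive presented_mul +%R.
Proof.
move=> u v w; have [x <-] := proj_surj u; have [y <-] := proj_surj v.
by have [z <-] := proj_surj w; rewrite -!projM -!projD -projM mulrDl.
Qed.

Fact presented_mulDr : right_distributive presented_mul +%R.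
Proof.
move=> u v w; have [x <-] := proj_surj u; have [y <-] := proj_surj v.
by have [z <-] := proj_surj w; rewrite -!projM -!projD -projM mulrDr.
Qed.

HB.instance Definition _ := GRing.Zmodule_isPzRing.Build presented
  presented_mulA presented_mul1 presented_mulr1 presented_mulDl presented_mulDr.

Fact presented_scaleA a b u :
  presented_scale a (presented_scale b u) = presented_scale (a * b) u.
Proof. by have [x <-] := proj_surj u; rewrite -!projZ scalerA. Qed.

Fact presented_scale1 : left_id 1 presented_scale.
Proof. by move=> u; have [x <-] := proj_surj u; rewrite -projZ scale1r. Qed.

Fact presented_scaleDr : right_distributive presented_scale +%R.
Proof.
move=> a u v; have [x <-] := proj_surj u; have [y <-] := proj_surj v.
by rewrite -!projZ -!projD -projZ scalerDr.
Qed.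

Fact presented_scaleDl u : {morph presented_scale^~ u : a b / a + b}.
Proof.
by move=> a b; have [x <-] := proj_surj u; rewrite -!projZ -projD scalerDl.
Qed.

HB.instance Definition _ := GRing.Zmodule_isLmodule.Build K presented
  presented_scaleA presented_scale1 presented_scaleDr presented_scaleDl.

Fact proj_is_monoid_morphism : monoid_morphism proj.
Proof. by split=> [|x y]; last exact: projM. Qed.

HB.instance Definition _ :=
  GRing.isMonoidMorphism.Build A presented proj proj_is_monoid_morphism.

HB.instance Definition _ := GRing.isScalable.Build K A presented *:%R proj projZ.

Fact presented_scaleAl (c : K) (u v : presented) : c *: (u * v) = c *: u * v.
Proof.
have [x <-] := proj_surj u; have [y <-] := proj_surj v.
transitivity (proj (c *: (x * y))); first by rewrite projZ projM.
by rewrite scalerAl projM projZ.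
Qed.

Fact presented_scaleAr (c : K) (u v : presented) : c *: (u * v) = u * (c *: v).
Proof.
have [x <-] := proj_surj u; have [y <-] := proj_surj v.
transitivity (proj (c *: (x * y))); first by rewrite projZ projM.
by rewrite scalerAr projM projZ.
Qed.

(* the easy half of the universal property, used for non-triviality *)
Lemma ideal_kernel (B : pzRingType) (f : {rmorphism A -> B}) :
  (forall x y, r x y -> f x = f y) -> forall x, x \in I -> f x = 0.
Proof.
move=> fr x /asboolP; elim=> {x} [x y /fr E||x y _ fx _ fy|a x _ fx|a x _ fx].
- by rewrite rmorphB E subrr.
- exact: rmorph0.
- by rewrite rmorphD fx fy addr0.
- by rewrite rmorphM fx mulr0.
- by rewrite rmorphM fx mul0r.
Qed.

End PresentedAlgebraTheory.

Section YokonumaHecke.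
Variables (F : fieldType) (d n : nat).

Local Notation K := (laurent F).
Local Notation yh_gen := ('I_n.-1 + 'I_n)%type.

(* The algebra is defined over F[q, q^-1] for any field F; the scalar 1/d in e_i
   has its usual meaning only when d != 0 in F. The case of interest is F = R[i]
   with R : realType, the complex numbers.
   g_1, ..., g_(n-1) are indexed by 'I_n.-1 and t_1, ..., t_n by 'I_n: all
   indices are shifted down by one. For i : 'I_n.-1, ord_low i and ord_high i
   are i and i.+1, seen in 'I_n. *)
Definition ord_low (i : 'I_n.-1) : 'I_n := widen_ord (leq_pred n) i.

Fact ord_high_subproof (i : 'I_n.-1) : (i.+1 < n)%N.
Proof. by rewrite -ltn_predRL. Qed.

Definition ord_high (i : 'I_n.-1) : 'I_n := Ordinal (ord_high_subproof i).

Definition adj_tperm (i : 'I_n.-1) : 'S_n := tperm (ord_low i) (ord_high i).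

Definition yh_free := free_algebra K yh_gen.

HB.instance Definition _ := GRing.Algebra.on yh_free.

Definition free_g (i : 'I_n.-1) : yh_free := free_gen K (inl i).
Definition free_t (j : 'I_n) : yh_free := free_gen K (inr j).

(* t_(i+1)^(-s) is written t_(i+1)^(d-s), which agrees with it as t_(i+1)^d = 1
   is one of the relations (see yh_tXV below) *)
Definition free_e (i : 'I_n.-1) : yh_free :=
  laurentC (d%:R^-1) *:
    \sum_(s < d) free_t (ord_low i) ^+ s * free_t (ord_high i) ^+ (d - s).

Inductive yh_rel : yh_free -> yh_free -> Prop :=
| yh_gg (i j : 'I_n.-1) : (i.+1 < j)%N || (j.+1 < i)%N ->
    yh_rel (free_g i * free_g j) (free_g j * free_g i)
| yh_ggg (i j : 'I_n.-1) : j = i.+1 :> nat ->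
    yh_rel (free_g i * free_g j * free_g i) (free_g j * free_g i * free_g j)
| yh_tt (i j : 'I_n) :
    yh_rel (free_t i * free_t j) (free_t j * free_t i)
| yh_tg (j : 'I_n) (i : 'I_n.-1) :
    yh_rel (free_t j * free_g i) (free_g i * free_t (adj_tperm i j))
| yh_td (j : 'I_n) : yh_rel (free_t j ^+ d) 1
| yh_g2 (i : 'I_n.-1) :
    yh_rel (free_g i ^+ 2)
      (1 + (laurentX _ - laurentXV _) *: (free_e i * free_g i)).

Definition yokonuma_hecke := presented yh_rel.

HB.instance Definition _ := GRing.PzRing.on yokonuma_hecke.
HB.instance Definition _ := GRing.Lmodule.on yokonuma_hecke.

(* Non-triviality: t_j |-> 1, g_i |-> q is a one-dimensional representation
   (if d = 0 in F, take g_i |-> 1 as then e_i = 0). *)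
Definition triv_rep (w : {fmonom yh_gen}) : K :=
  \prod_(x <- (w : seq _))
    (if x is inl _ then if d%:R == 0 :> F then 1 else laurentX _ else 1).

Fact triv_rep_mmorphism : mmorphism triv_rep.
Proof.
split=> [x y|]; rewrite /triv_rep; first by rewrite fmM big_cat.
by rewrite fm1 big_nil.
Qed.

HB.instance Definition _ :=
  isMultiplicative.Build {fmonom yh_gen} K triv_rep triv_rep_mmorphism.

Fact yokonuma_hecke_oner_neq0 : (1 : yokonuma_hecke) != 0.
Proof.
have [f fU f_scale] : exists2 f : {rmorphism yh_free -> K},
    forall x, f (free_gen K x)
      = if x is inl _ then if d%:R == 0 :> F then 1 else laurentX _ else 1
  & forall c x, f (c *: x) = c * f x.
  pose f : {rmorphism yh_free -> K} := mmap idfun triv_rep.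
  exists f => [x|c x]; last by rewrite /f /= mmapZ.
  by rewrite /f free_gen.unlock /= mmapU /= mul1r /triv_rep fmU big_seq1; case: x.
have fM x y a b : f x = a -> f y = b -> f (x * y) = a * b.
  by move=> <- <-; exact: rmorphM.
have fX k x a : f x = a -> f (x ^+ k) = a ^+ k.
  by move=> <-; exact: rmorphXn.
have fD x y a b : f x = a -> f y = b -> f (x + y) = a + b.
  by move=> <- <-; exact: rmorphD.
have fZ c x a : f x = a -> f (c *: x) = c * a by move=> <-; exact: f_scale.
have f1 : f 1 = 1 by exact: rmorph1.
pose Q : K := if d%:R == 0 :> F then 1 else laurentX _.
have fg i : f (free_g i) = Q by exact: fU.
have ft j : f (free_t j) = 1 by exact: fU.
have fe i : f (free_e i) = laurentC d%:R^-1 * d%:R.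
  apply: fZ; rewrite raddf_sum (eq_bigr (fun=> 1)) ?sumr_const ?card_ord //.
  move=> s _; apply: (etrans (fM _ _ _ _ (fX _ _ _ (ft _)) (fX _ _ _ (ft _)))).
  by rewrite !expr1n mulr1.
have fr x y : yh_rel x y -> f x = f y.
  case=> {x y} [i j _|i j _|i j|j i|j|i].
  - exact: etrans (fM _ _ _ _ (fg i) (fg j)) (esym (fM _ _ _ _ (fg j) (fg i))).
  - have fggg k l : f (free_g k * free_g l * free_g k) = Q * Q * Q.
      exact: fM (fM _ _ _ _ (fg k) (fg l)) (fg k).
    exact: etrans (fggg i j) (esym (fggg j i)).
  - exact: etrans (fM _ _ _ _ (ft i) (ft j)) (esym (fM _ _ _ _ (ft j) (ft i))).
  - apply: etrans (fM _ _ _ _ (ft _) (fg i)) _.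
    by apply: etrans (mulrC _ _) (esym (fM _ _ _ _ (fg i) (ft _))).
  - by apply: etrans (fX _ _ _ (ft j)) _; rewrite f1 expr1n.
  - apply: etrans (fX _ _ _ (fg i)) _; apply: esym.
    apply: etrans (fD _ _ _ _ f1 (fZ _ _ _ (fM _ _ _ _ (fe i) (fg i)))) _.
    rewrite /Q; have [d0|d0] := eqVneq (d%:R : F) 0.
      by rewrite d0 invr0 rmorph0 !mul0r mulr0 addr0 expr1n.
    have -> : d%:R = laurentC (d%:R : F) by rewrite rmorph_nat.
    rewrite -rmorphM mulVf // rmorph1 mul1r.
    by rewrite mulrBl [laurentXV _ * _]mulrC laurentXXV addrC subrK expr2.
apply/eqP => e10; have /projP : proj yh_rel 1 = proj yh_rel 0.
  by rewrite [RHS]raddf0.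
rewrite subr0 => /(ideal_kernel fr) /eqP.
by rewrite f1 oner_eq0.
Qed.

HB.instance Definition _ :=
  GRing.PzSemiRing_isNonZero.Build yokonuma_hecke yokonuma_hecke_oner_neq0.
HB.instance Definition _ := GRing.Lmodule_isLalgebra.Build K yokonuma_hecke
  (@presented_scaleAl _ _ yh_rel).
HB.instance Definition _ := GRing.Lalgebra_isAlgebra.Build K yokonuma_hecke
  (@presented_scaleAr _ _ yh_rel).

Definition yh_g (i : 'I_n.-1) : yokonuma_hecke := proj yh_rel (free_g i).
Definition yh_t (j : 'I_n) : yokonuma_hecke := proj yh_rel (free_t j).

Definition yh_e (i : 'I_n.-1) : yokonuma_hecke :=
  laurentC (d%:R^-1) *:
    \sum_(s < d) yh_t (ord_low i) ^+ s * yh_t (ord_high i) ^+ (d - s).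

Fact proj_yhM x y a b :
  proj yh_rel x = a -> proj yh_rel y = b -> proj yh_rel (x * y) = a * b :> yokonuma_hecke.
Proof. by move=> <- <-; exact: projM. Qed.

Fact proj_yhX k x a :
  proj yh_rel x = a -> proj yh_rel (x ^+ k) = a ^+ k :> yokonuma_hecke.
Proof. by move=> <-; exact: rmorphXn. Qed.

Fact proj_yhZ c x a :
  proj yh_rel x = a -> proj yh_rel (c *: x) = c *: a :> yokonuma_hecke.
Proof. by move=> <-; exact: projZ. Qed.

Fact proj_g i : proj yh_rel (free_g i) = yh_g i. Proof. by []. Qed.
Fact proj_t j : proj yh_rel (free_t j) = yh_t j. Proof. by []. Qed.

Fact proj_e i : proj yh_rel (free_e i) = yh_e i.
Proof.
apply: proj_yhZ; rewrite raddf_sum; apply: eq_bigr => s _.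
exact: proj_yhM (proj_yhX _ (proj_t _)) (proj_yhX _ (proj_t _)).
Qed.

Fact yh_rel_eq x y (a b : yokonuma_hecke) :
  yh_rel x y -> proj yh_rel x = a -> proj yh_rel y = b -> a = b.
Proof. by move=> rxy <- <-; exact: proj_rel. Qed.

Lemma yh_ggC (i j : 'I_n.-1) : (i.+1 < j)%N || (j.+1 < i)%N ->
  yh_g i * yh_g j = yh_g j * yh_g i.
Proof.
move=> ij; apply: (yh_rel_eq (yh_gg ij)).
  exact: proj_yhM (proj_g i) (proj_g j).
exact: proj_yhM (proj_g j) (proj_g i).
Qed.

Lemma yh_braid (i j : 'I_n.-1) : j = i.+1 :> nat ->
  yh_g i * yh_g j * yh_g i = yh_g j * yh_g i * yh_g j.
Proof.
move=> ij; apply: (yh_rel_eq (yh_ggg ij)).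
  exact: proj_yhM (proj_yhM (proj_g i) (proj_g j)) (proj_g i).
exact: proj_yhM (proj_yhM (proj_g j) (proj_g i)) (proj_g j).
Qed.

Lemma yh_ttC (i j : 'I_n) : yh_t i * yh_t j = yh_t j * yh_t i.
Proof.
apply: (yh_rel_eq (yh_tt i j)).
  exact: proj_yhM (proj_t i) (proj_t j).
exact: proj_yhM (proj_t j) (proj_t i).
Qed.

Lemma yh_tgE (j : 'I_n) (i : 'I_n.-1) :
  yh_t j * yh_g i = yh_g i * yh_t (adj_tperm i j).
Proof.
apply: (yh_rel_eq (yh_tg j i)).
  exact: proj_yhM (proj_t j) (proj_g i).
exact: proj_yhM (proj_g i) (proj_t _).
Qed.

Lemma yh_tX (j : 'I_n) : yh_t j ^+ d = 1.
Proof. by apply: (yh_rel_eq (yh_td j)) => //; exact: proj_yhX (proj_t j). Qed.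

Lemma yh_tXV (j : 'I_n) (s : 'I_d) : yh_t j ^+ s * yh_t j ^+ (d - s) = 1.
Proof. by rewrite -exprD subnKC ?yh_tX // ltnW. Qed.

Lemma yh_gX2 (i : 'I_n.-1) :
  yh_g i ^+ 2 = 1 + (laurentX F - laurentXV F) *: (yh_e i * yh_g i).
Proof.
apply: (yh_rel_eq (yh_g2 i)); first exact: proj_yhX (proj_g i).
apply: etrans (projD _ _ _) _; apply: (congr1 ( +%R 1)).
exact: proj_yhZ (proj_yhM (proj_e i) (proj_g i)).
Qed.

Fixpoint yh_J_rec (k : nat) : (k < n)%N -> yokonuma_hecke :=
  if k is k'.+1 then
    fun lt_kn =>
      let i := Ordinal (etrans (ltn_predRL k' n) lt_kn) in
      yh_g i * yh_J_rec (ltnW lt_kn) * yh_g i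
  else fun=> 1.

Definition yh_J (j : 'I_n) : yokonuma_hecke := yh_J_rec (ltn_ord j).

Lemma yh_J1 (j : 'I_n) : j = 0%N :> nat -> yh_J j = 1.
Proof. by case: j => -[|k] ltkn. Qed.

Lemma yh_JS (i : 'I_n.-1) :
  yh_J (ord_high i) = yh_g i * yh_J (ord_low i) * yh_g i.
Proof.
rewrite /yh_J /=; set j := Ordinal _; have -> : j = i by apply: val_inj.
by congr (_ * yh_J_rec _ * _); apply: bool_irrelevance.
Qed.

Variant jucys_murphy : yokonuma_hecke -> Prop :=
| jucys_murphy_t (j : 'I_n) : jucys_murphy (yh_t j)
| jucys_murphy_J (j : 'I_n) : jucys_murphy (yh_J j).

End YokonumaHecke.

(* Main.v *)
Require Import Defs.
From mathcomp Require Import all_boot all_algebra complex reals.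
From mathcomp Require Import perm.
Local Open Scope ring_scope.

(** Commutativity is a property of the framed braid monoid: it follows from the
braid relations and from t_j g_i = g_i t_(s_i j).  Indices start at 0, so that
g_i exchanges the strands i and i+1, J_0 = 1 and J_(i+1) = g_i J_i g_i.

- Moving t_j across J_(i+1) applies the transposition s_i to its index twice,
  so t_j comes out unchanged (yh_t_J_comm).
- J_k is a word in g_0, ..., g_(k-1), so g_i commutes with it by far
  commutativity when i > k (yh_g_J_comm_below).  When i < k - 1, far
  commutativity reduces to k = i + 2, where
  J_k = g_(i+1) g_i J_i g_i g_(i+1): a braid move turns the g_i entering on the
  left into a g_(i+1), which passes through J_i and is turned back into a g_i
  on the right (comm_braid_sandwich, yh_g_J_comm_above).
- For k < l, every letter g_i of J_k satisfies i < l - 1, so it commutes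
  with J_l; hence so does J_k (yh_J_J_comm_lt). *)

Import GRing.Theory.

(** [yh_JS] describes the Jucys-Murphy elements through [ord_low] and
[ord_high]; this is the induction principle on indices that matches it. *)
Lemma ord_low_high_ind (n : nat) (P : 'I_n -> Prop) :
  (forall j : 'I_n, j = 0%N :> nat -> P j) ->
  (forall i : 'I_n.-1, P (ord_low i) -> P (ord_high i)) ->
  forall j : 'I_n, P j.
Proof.
move=> P0 PS [k ltkn]; elim: k ltkn => [|k IHk] ltkn; first exact: P0.
have ltkn1 : (k < n.-1)%N by rewrite ltn_predRL.
have -> : Ordinal ltkn = ord_high (Ordinal ltkn1) by exact: val_inj.
apply: PS; have -> : ord_low (Ordinal ltkn1) = Ordinal (ltnW ltkn).
  exact: val_inj.
exact: IHk.
Qed.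

(** The braid relation gives (a b) a = b (a b) and, read backwards,
b (a b) = (a b) a: crossing b a from the left changes a into b, and crossing
a b changes b back into a. *)
Lemma comm_braid_sandwich (A : pzRingType) (a b x : A) :
  a * b * a = b * a * b -> GRing.comm b x ->
  GRing.comm a (b * (a * x * a) * b).
Proof.
rewrite /GRing.comm => braid bx.
transitivity (a * b * a * x * (a * b)); first by rewrite !mulrA.
rewrite braid -(mulrA (b * a)) bx.
transitivity (b * a * x * (b * a * b)); first by rewrite !mulrA.
by rewrite -braid !mulrA.
Qed.

Section JucysMurphy.
Variables (F : fieldType) (d n : nat).

Local Notation g := (@yh_g F d n).
Local Notation t := (@yh_t F d n).
Local Notation J := (@yh_J F d n).

Lemma yh_t_J_comm (j k : 'I_n) : GRing.comm (t j) (J k).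
Proof.
elim/ord_low_high_ind: k j => [k k0 j|i IHi j].
  by rewrite yh_J1 //; exact: commr1.
rewrite /GRing.comm yh_JS.
transitivity (t j * g i * (J (ord_low i) * g i)); first by rewrite !mulrA.
rewrite yh_tgE -mulrA (mulrA (t _)) IHi -(mulrA (J _)) yh_tgE.
by rewrite tpermK !mulrA.
Qed.

(** J_k is a word in g_0, ..., g_(k-1), none of which is adjacent to g_i. *)
Lemma yh_g_J_comm_below (i : 'I_n.-1) (k : 'I_n) :
  (k < i)%N -> GRing.comm (g i) (J k).
Proof.
elim/ord_low_high_ind: k => [k k0 _|k IHk ki].
  by rewrite yh_J1 //; exact: commr1.
have gik : GRing.comm (g i) (g k) by apply: yh_ggC; rewrite orbC ki.
by rewrite yh_JS; apply: commrM => //; apply: commrM => //; exact/IHk/ltnW.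
Qed.

(** Peeling off the outer letters of J_k by far commutativity stops at
k = i + 2, whose outer letter g_(i+1) is adjacent to g_i; the braid relation
starts the induction there. *)
Lemma yh_g_J_comm_above (i : 'I_n.-1) (k : 'I_n) :
  (i.+1 < k)%N -> GRing.comm (g i) (J k).
Proof.
elim/ord_low_high_ind: k => [k -> //|k IHk].
move/ltnSE; rewrite leq_eqVlt => /orP[/eqP k_eq|ik].
- have low_k : ord_low k = ord_high i by apply: val_inj.
  rewrite yh_JS low_k yh_JS; apply: comm_braid_sandwich; first exact: yh_braid.
  by apply: yh_g_J_comm_below; rewrite -k_eq /=.
- have gik : GRing.comm (g i) (g k) by apply: yh_ggC; rewrite ik.
  by rewrite yh_JS; apply: commrM => //; apply: commrM => //; exact: IHk.
Qed.

(** Every letter g_i of J_k satisfies i + 1 <= k < l. *)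
Lemma yh_J_J_comm_lt (k l : 'I_n) : (k < l)%N -> GRing.comm (J k) (J l).
Proof.
move=> kl; apply: commr_sym; elim/ord_low_high_ind: k kl => [k k0 _|i IHi il].
  by rewrite [J k]yh_J1 //; exact: commr1.
have gJ : GRing.comm (J l) (g i).
  by apply: commr_sym; exact: yh_g_J_comm_above.
by rewrite yh_JS; apply: commrM => //; apply: commrM => //; exact/IHi/ltnW.
Qed.

Lemma yh_J_J_comm (k l : 'I_n) : GRing.comm (J k) (J l).
Proof.
case: (ltngtP k l) => [kl|lk|/val_inj ->]; last exact: commr_refl.
- exact: yh_J_J_comm_lt.
- exact/commr_sym/yh_J_J_comm_lt.
Qed.

End JucysMurphy.

Theorem corollary2 (R : realType) (d n : nat) (d_ge1 : (1 <= d)%N)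
    (n_ge1 : (1 <= n)%N) (x y : yokonuma_hecke R[i] d n) :
  jucys_murphy x -> jucys_murphy y -> x * y = y * x.
Proof.
case=> [j|j] [k|k].
- exact: yh_ttC.
- exact: yh_t_J_comm.
- exact/commr_sym/yh_t_J_comm.
- exact: yh_J_J_comm.
Qed.
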